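(* Let $X$ be a locally compact, separable, completely metrizable topological space, let $\mathcal{P}$ be a closed set (in the closed convergence topology) of locally strict preferences on $X$, and let $\{\Sigma_n\}_{n\in\mathbb{N}}$, $\Sigma_n=\{B_1,\dots,B_n\}$, be an exhaustive set of growing experiments. Let $c$ be an arbitrary choice function. If, for every $n$, the preference $\succeq_n\in\mathcal{P}$ rationalizes the observed choices on $\Sigma_n$, then there exists a preference $\succeq^*\in\mathcal{P}$ such that $\succeq_n\to\succeq^*$. Moreover, the limiting preference is unique: if, for every $n$, $\succeq_n'\in\mathcal{P}$ rationalizes the observed choices on $\Sigma_n$, then the same limit $\succeq_n'\to\succeq^*$ obtains.
   Context: A preference on a topological space $X$ is a binary relation $\succeq\,\subseteq X\times X$ that is complete (for all $x,y$, $x\succeq y$ or $y\succeq x$) and continuous (closed as a subset of $X\times X$); transitivity is not required. $x\succ y$ means $x\succeq y$ and not $y\succeq x$. A preference $\succeq$ is locally strict if for all $x,y\in X$ with $x\succeq y$ and every neighborhood $V$ of $(x,y)$ in $X\times X$ there is $(x',y')\in V$ with $x'\succ y'$. Convergence: $\succeq_n\to\succeq^*$ means (1) for all $x^*\succeq^* y^*$ there is a sequence $(x_n,y_n)\to(x^*,y^* )$ with $x_n\succeq_n y_n$ for all $n$; and (2) for every subsequence $\{\succeq_{n_k}\}_k$ and every pair $(x^*,y^* )$ that is the limit of a sequence $(x_{n_k},y_{n_k})$ with $x_{n_k}\succeq_{n_k}y_{n_k}$ for all $k$, we have $x^*\succeq^* y^*$. For $X$ as in the claim this is convergence in the closed convergence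 topology on the space of continuous binary relations (closed subsets of $X\times X$), which is metrizable; ''closed'' refers to this topology. Each $B_k=\{x_k,y_k\}\subseteq X$ is an unordered pair of alternatives (a binary choice problem). The set of experiments is exhaustive if (1) $\bigcup_{k=1}^\infty B_k$ is dense in $X$, and (2) for all $x\neq y$ in $\bigcup_{k=1}^\infty B_k$ there is $k$ with $B_k=\{x,y\}$. A choice function $c$ assigns to each unordered pair $\{x,y\}\subseteq X$ an element $c(\{x,y\})\in\{x,y\}$. A preference $\succeq$ rationalizes the observed choices on $\Sigma_n$ if for every $\{x,y\}\in\Sigma_n$, $c(\{x,y\})\succeq x$ and $c(\{x,y\})\succeq y$. *)

(* Defs.v *)
From HB Require Import structures.
From mathcomp Require Import all_boot all_order all_algebra.
From mathcomp Require Import all_classical reals topology.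

Set Implicit Arguments.
Unset Strict Implicit.
Unset Printing Implicit Defensive.

Import Order.TTheory GRing.Theory Num.Theory.

Local Open Scope classical_set_scope.
Local Open Scope ring_scope.

Definition separable_space (X : topologicalType) : Prop :=
  exists2 D : set X, countable D & dense D.

Definition is_metric (R : realType) (X : Type) (d : X -> X -> R) : Prop :=
  [/\ forall x y, 0 <= d x y,
      forall x y, d x y = 0 <-> x = y,
      forall x y, d x y = d y x &
      forall x y z, d x z <= d x y + d y z].

Definition completely_metrizable (R : realType) (X : topologicalType) : Prop :=
  exists d : X -> X -> R,
    [/\ is_metric d,
        forall (x : X) (A : set X),
          nbhs x A <-> exists2 e : R, 0 < e & [set y | d x y < e] `<=` A &
        forall u : nat -> X,
          (forall e : R, 0 < e -> exists N : nat,
             forall m n : nat, (N <= m)%N -> (N <= n)%N -> d (u m) (u n) < e) ->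
          exists l : X, u @ \oo --> l].

(* The hyperspace of the closed subsets of T, the empty set included. *)
Record closed_set (T : topologicalType) := ClosedSet {
  set_of_closed :> set T;
  closed_setP : closed set_of_closed }.

HB.instance Definition _ (T : topologicalType) := gen_eqMixin (closed_set T).
HB.instance Definition _ (T : topologicalType) :=
  gen_choiceMixin (closed_set T).

(* Subbase of the closed convergence (Fell) topology: the closed sets missing
   a given compact set, and the closed sets hitting a given open set. *)
Definition closed_convergence_subbase (T : topologicalType) :
    set (set (closed_set T)) :=
  [set W | (exists2 K : set T, compact K &
              W = [set F : closed_set T | (F : set T) `&` K = set0]) \/
           (exists2 G : set T, open G &
              W = [set F : closed_set T | (F : set T) `&` G !=set0])].

HB.instance Definition _ (T : topologicalType) :=
  isSubBaseTopological.Build (closed_set T)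
    (@closed_convergence_subbase T) id.

(* A binary relation on X is a subset of X * X: [Q (x, y)] reads "x is weakly
   preferred to y". *)
Definition preference (X : topologicalType) (Q : set (X * X)) : Prop :=
  (forall x y, Q (x, y) \/ Q (y, x)) /\ closed Q.

Definition strict_part (X : Type) (Q : set (X * X)) (x y : X) : Prop :=
  Q (x, y) /\ ~ Q (y, x).

Definition locally_strict (X : topologicalType) (Q : set (X * X)) : Prop :=
  forall x y : X, Q (x, y) ->
    forall V : set (X * X), nbhs (x, y) V ->
      exists x' y' : X, V (x', y') /\ strict_part Q x' y'.

Definition preference_cvg (X : topologicalType)
    (Qn : nat -> set (X * X)) (Q : set (X * X)) : Prop :=
  (forall z : X * X, Q z ->
     exists u : nat -> X * X, (forall n, Qn n (u n)) /\ u @ \oo --> z) /\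
  (forall (phi : nat -> nat) (u : nat -> X * X) (z : X * X),
     {homo phi : m n / (m < n)%N} ->
     (forall k, Qn (phi k) (u k)) -> u @ \oo --> z -> Q z).

(* Unordered pairs are subsets [set x; y]; x = y is not excluded. *)
Definition binary_problem (X : Type) (A : set X) : Prop :=
  exists x y : X, A = [set x; y].

(* Only the values of c on unordered pairs are meaningful. *)
Definition choice_function (X : Type) (c : set X -> X) : Prop :=
  forall x y : X, [set x; y] (c [set x; y]).

(* Indices start at 0, so [experiments B n] consists of the first n+1
   problems and is never empty. *)
Definition experiments (X : Type) (B : nat -> set X) (n : nat) :
    set (set X) := [set B k | k in [set k | (k <= n)%N]].

Definition exhaustive (X : topologicalType) (B : nat -> set X) : Prop :=
  dense (\bigcup_k B k) /\
  forall x y : X, (\bigcup_k B k) x -> (\bigcup_k B k) y -> x <> y ->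
    exists k, B k = [set x; y].

Definition rationalizes (X : Type) (c : set X -> X) (Sigma : set (set X))
    (Q : set (X * X)) : Prop :=
  forall x y : X, Sigma [set x; y] ->
    Q (c [set x; y], x) /\ Q (c [set x; y], y).

(* Main.v *)
(* The closed convergence topology on the closed subsets of any space is
   compact, so the sequence has a cluster point, and every cluster point lies
   in P and still makes all the observed choices.  Two locally strict
   preferences Q, Q' making all these choices are equal: if (x, y) is in Q but
   not in Q', local strictness yields near (x, y) a strict Q-comparison, which
   persists on an open set disjoint from Q'; a pair (a, b) of observed
   alternatives in that set has a chosen according to Q and b chosen according
   to Q'.  A sequence with a unique cluster point in a compact space converges,
   and this convergence implies the sequential one. *)

Require Import Defs.
From mathcomp Require Import all_boot all_order all_algebra.
From mathcomp Require Import all_classical reals topology.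
Import Order.TTheory GRing.Theory Num.Theory.

Local Open Scope classical_set_scope.

(** If a neighbourhood [A] of [q] were not in [F], the traces of [F] on the complement of [A] would
    generate a proper filter [G] finer than [F]; a cluster point of [G] is one of [F], hence [q],
    although [A] misses a member of [G]. *)
Lemma compact_unique_cluster_cvg {T : topologicalType} (F : set_system T)
    (q : T) : compact [set: T] -> ProperFilter F -> cluster F `<=` [set q] ->
  F --> q.
Proof.
move=> Tco FF Fq A Aq; apply: contrapT => nFA.
pose G := filter_from F (fun B => B `&` ~` A).
have GF : ProperFilter G.
  apply: filter_from_proper; last first.
    move=> B FB; apply: contrapT => nBA; apply: nFA.
    by apply: filterS FB => x Bx; apply: contrapT => nAx; apply: nBA; exists x.
  apply: filter_from_filter; first by exists setT; exact: filterT.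
  move=> B C FB FC; exists (B `&` C); first exact: filterI.
  by move=> x [[]].
have FG : F `<=` G by move=> B FB; exists B => // x [].
have [p [_ Gp]] := Tco G GF filterT.
have pq : p = q by apply: Fq; exact: cvg_cluster Gp.
have GA : G (~` A) by exists setT; [exact: filterT | move=> x []].
by have [x []] := Gp _ _ GA (eq_rect_r (nbhs^~ A) Aq pq).
Qed.

(** A filter that does not cluster at [z] has a member [A] missing a neighbourhood of [z]; this [A]
    meets the set only in finitely many terms of [u], and finite sets are compact. *)
Lemma compact_cvg_tail {T : topologicalType} (u : nat -> T) (z : T) (N : nat) :
  u @ \oo --> z -> compact (z |` [set u k | k in [set k | (N <= k)%N]]).
Proof.
move=> uz F FF FK.
have [zF|] := pselect (cluster F z); first by exists z; split => //; left.
move=> /existsNP[A /existsNP[V /not_implyP[FA /not_implyP[zV AV]]]].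
have [M _ uM] := uz V zV.
set K := _ |` _ in FK *.
have fin : finite_set (A `&` K).
  apply: (@sub_finite_set _ _ (u @` `I_M)); last exact: finite_image.
  move=> x [Ax [xz|[k /= Nk ukx]]].
    by exfalso; apply: AV; exists x; split => //; rewrite xz; exact: nbhs_singleton.
  exists k => //=; rewrite ltnNge; apply/negP => Mk; apply: AV; exists x.
  by split => //; rewrite -ukx; exact: (uM k).
have [x [[_ Kx] Fx]] := finite_compact fin FF (filterI FA FK).
by exists x.
Qed.

(** * The closed convergence topology and its compactness *)

Section closed_convergence.
Context {T : topologicalType}.
Implicit Types (F : set_system (closed_set T)) (Q : closed_set T).

Lemma open_closed_convergence_subbase (W : set (closed_set T)) :
  @closed_convergence_subbase T W -> open W.
Proof.
move=> DW; exists [set W]; last by rewrite bigcup_set1.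
by move=> _ ->; exact: finI_from1.
Qed.

Lemma open_miss_compact (K : set T) : compact K ->
  open [set Q : closed_set T | (Q : set T) `&` K = set0].
Proof.
by move=> Kco; apply: open_closed_convergence_subbase; left; exists K.
Qed.

Lemma open_hit_open (G : set T) : open G ->
  open [set Q : closed_set T | (Q : set T) `&` G !=set0].
Proof.
by move=> Go; apply: open_closed_convergence_subbase; right; exists G.
Qed.

Lemma closed_convergence_cvg F Q : Filter F ->
  (forall W, @closed_convergence_subbase T W -> W Q -> F W) -> F --> Q.
Proof.
move=> FF FW A; rewrite nbhsE => -[O [[D sD <-] [C DC CQ]] OA].
apply: (filterS OA); have [E sE EC] := sD _ DC.
apply: (@filterS _ F _ C); first by move=> x Cx; exists C.
rewrite -EC; apply: filter_bigI => W WE.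
apply: FW; first by have := sE _ WE; rewrite inE.
by move: CQ; rewrite -EC; apply.
Qed.

Lemma closed_set_compact : compact [set: closed_set T].
Proof.
rewrite compact_ultra => F FU _.
(* L is the limit along the ultrafilter F. *)
pose L := [set z : T | forall V, nbhs z V ->
  F [set Q : closed_set T | (Q : set T) `&` V !=set0]].
have Lcl : closed L.
  move=> z zL V; rewrite nbhsE => -[O [Oo Oz] OV].
  have [w [Lw Ow]] := zL O (open_nbhs_nbhs (conj Oo Oz)).
  apply: filterS (Lw O (open_nbhs_nbhs (conj Oo Ow))) => Q [x [Qx Ox]].
  by exists x; split => //; exact: OV.
exists (ClosedSet Lcl); split => //; apply: closed_convergence_cvg.
move=> W [[K Kco ->]|[G Go ->]] /=; last first.
  by move=> [z [Lz Gz]]; apply: Lz; exact: open_nbhs_nbhs.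
move=> LK; have /compact_near_coveringP Kcov := Kco.
(* As [F] is an ultrafilter, each point outside [L] has a neighbourhood missed by all sets in some
   member of [F]; compactness of [K] yields one member that serves all of [K]. *)
have /filterS : F [set Q : closed_set T | K `<=` [set x | ~ (Q : set T) x]].
  apply: Kcov => z Kz.
  have /existsNP[V /not_implyP[zV nFV]] : ~ L z.
    by move=> Lz; have : set0 z by rewrite -LK; split.
  have [//|FV] := in_ultra_setVsetC
    [set Q : closed_set T | (Q : set T) `&` V !=set0] FU.
  exists (V, ~` [set Q : closed_set T | (Q : set T) `&` V !=set0]) => //=.
  by move=> [x Q] /= [Vx nQV] Qx; apply: nQV; exists x.
apply=> Q KQ; rewrite /= -subset0 => x [Qx Kx]; exact: KQ Qx.
Qed.

End closed_convergence.

(** * From topological to sequential convergence *)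

(** Diagonal choice: [u n] lies in [G j] for the largest [j <= n] such that [A n] meets [G j], and
    is any point of [A n] if there is no such [j]. *)
Lemma nat_selection {T : Type} (A : nat -> set T) (G : nat -> set T) :
  (forall n, A n !=set0) -> (forall i j, (i <= j)%N -> G j `<=` G i) ->
  (forall j, \forall n \near \oo, A n `&` G j !=set0) ->
  exists u : nat -> T, (forall n, A n (u n)) /\
    forall j, \forall n \near \oo, G j (u n).
Proof.
move=> A0 Gmono AG.
have [u uP] : {u : nat -> T & forall n, A n (u n) /\
    forall j, (j <= n)%N -> A n `&` G j !=set0 -> G j (u n)}.
  apply: (@choice _ _ (fun n w => A n w /\
    forall j, (j <= n)%N -> A n `&` G j !=set0 -> G j w)) => n.
  (* The bound on [j] is separated from [n] so that the induction leaves [A n] fixed. *)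
  suff: forall m, exists w, A n w /\
      forall j, (j <= m)%N -> A n `&` G j !=set0 -> G j w by exact.
  elim=> [|m [w [Aw wG]]].
    have [[w [Aw Gw]]|A0n] := pselect (A n `&` G 0%N !=set0).
      by exists w; split => // j; rewrite leqn0 => /eqP->.
    have [w Aw] := A0 n.
    by exists w; split => // j; rewrite leqn0 => /eqP->.
  have [[w' [Aw' Gw']]|nG] := pselect (A n `&` G m.+1 !=set0).
    by exists w'; split => // j jm _; exact: Gmono jm _ Gw'.
  exists w; split => // j; rewrite leq_eqVlt => /predU1P[->//|jm].
  exact: wG.
exists u; split => [n|j]; first by have [] := uP n.
near=> n; have [_] := uP n; apply; last by near: n; exact: AG.
by near: n; exact: nbhs_infty_ge.
Unshelve. all: by end_near. Qed.

Lemma metrizable_prod_nbhs_base (R : realType) {X : topologicalType} (z : X * X) :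
  completely_metrizable R X ->
  exists G : nat -> set (X * X), [/\ forall j, nbhs z (G j),
    forall i j, (i <= j)%N -> G j `<=` G i &
    forall V, nbhs z V -> exists j, G j `<=` V].
Proof.
move=> [d [_ dnbhs _]]; pose r j : R := (j.+1%:R^-1)%R.
(* Balls around [z] for the maximum metric, of radius [1/(j+1)]. *)
pose G j := [set w : X * X | (d z.1 w.1 < r j)%R /\ (d z.2 w.2 < r j)%R].
have r_gt0 j : (0 < r j)%R by rewrite invr_gt0 ltr0n.
have r_le i j : (i <= j)%N -> (r j <= r i)%R.
  by move=> ij; rewrite lef_pV2 ?posrE ?ltr0n// ler_nat ltnS.
have r_small (e : R) : (0 < e)%R -> exists i, (r i < e)%R.
  move=> e0; exists (Num.truncn e^-1)%R.
  by rewrite invf_plt ?posrE ?ltr0n// truncnS_gt.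
exists G; split => [j|i j ij w [w1 w2]|V].
- exists ([set x | (d z.1 x < r j)%R], [set x | (d z.2 x < r j)%R]) => /=.
    by split; apply/dnbhs; exists (r j).
  by move=> w [].
- by split; [move: w1|move: w2] => /lt_le_trans; apply; exact: r_le.
- move=> [[V1 V2] /= [/dnbhs[e1 e10 V1e] /dnbhs[e2 e20 V2e]] V12].
  have [i ie1] := r_small _ e10; have [j je2] := r_small _ e20.
  exists (maxn i j) => w [w1 w2]; apply: V12; split => /=.
    apply: V1e => /=; apply: lt_trans ie1; apply: lt_le_trans w1 _.
    by apply: r_le; exact: leq_maxl.
  apply: V2e => /=; apply: lt_trans je2; apply: lt_le_trans w2 _.
  by apply: r_le; exact: leq_maxr.
Qed.

(** Open sets of the hit type give the approximating sequences, those of the miss type exclude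
    limits outside [Q]. Reflexivity keeps every [Qn n] nonempty, so that points can be chosen at all
    indices. *)
Lemma closed_set_cvg_preference_cvg (R : realType) {X : topologicalType}
    (Qn : nat -> closed_set (X * X)%type) (Q : closed_set (X * X)%type) :
  completely_metrizable R X -> (forall n x, (Qn n : set _) (x, x)) ->
  Qn @ \oo --> Q -> preference_cvg (fun n => set_of_closed (Qn n)) Q.
Proof.
move=> Xm Qn_refl QnQ; split=> [z Qz|phi u z phi_mono Qu uz].
  have [G [Gz Gmono Gbase]] := metrizable_prod_nbhs_base R z Xm.
  have [|||u [Qu uG]] := nat_selection (fun n => set_of_closed (Qn n)) G.
  - by move=> n; exists (z.1, z.1).
  - exact: Gmono.
  - move=> j; have /QnQ[N _ QnG] : nbhs Q
        [set C : closed_set _ | (C : set (X * X)) `&` (G j)° !=set0].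
      apply: open_nbhs_nbhs; split; first exact/open_hit_open/open_interior.
      by exists z; split => //; exact: Gz.
    exists N => // n /QnG[w [Qw Gw]]; exists w; split => //.
    exact: interior_subset.
  exists u; split => // V /Gbase[j GV].
  by apply: filterS (uG j) => n; exact: GV.
apply: contrapT => nQz.
have nQzV : nbhs z (~` (Q : set (X * X))).
  by apply: open_nbhs_nbhs; split => //; apply: closed_openC; exact: closed_setP.
have [N _ uN] := uz _ nQzV.
(* This compact set plays the role of a compact neighbourhood of z. *)
pose K := z |` [set u k | k in [set k | (N <= k)%N]].
have /QnQ[M _ QnM] : nbhs Q
    [set C : closed_set _ | (C : set (X * X)) `&` K = set0].
  apply: open_nbhs_nbhs; split; first exact/open_miss_compact/compact_cvg_tail.
  rewrite /= -subset0 => w [Qw [wz|[k /= Nk ukw]]].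
    by apply: nQz; rewrite -wz.
  by apply: (uN k Nk); rewrite /= ukw.
have phi_ge k : (k <= phi k)%N.
  by elim: k => // k /leq_ltn_trans; apply; exact: phi_mono.
(* From [N] on, [u k] lies in [K]; from [M] on, as [k <= phi k], the set [Qn (phi k)] misses [K]. *)
pose k := maxn N M.
have : set0 (u k).
  rewrite -(QnM (phi k)) /=; last exact: leq_trans (leq_maxr _ _) (phi_ge _).
  by split => //; right; exists k => //=; exact: leq_maxl.
by [].
Qed.

(** * Observed choices determine the limit *)

Lemma dense_prod_nbhs {X : topologicalType} (D : set X) (z : X * X)
    (V : set (X * X)) : dense D -> nbhs z V ->
  exists a b, [/\ D a, D b & V (a, b)].
Proof.
move=> Dd [[V1 V2] /= [zV1 zV2] V12].
have [a [Va Da]] : V1° `&` D !=set0.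
  by apply: Dd; [exists z.1 | exact: open_interior].
have [b [Vb Db]] : V2° `&` D !=set0.
  by apply: Dd; [exists z.2 | exact: open_interior].
by exists a, b; split => //; apply: V12; split; exact: interior_subset.
Qed.

Lemma locally_strict_rationalizes_subset {X : topologicalType}
    (B : nat -> set X) (c : set X -> X) (Q Q' : set (X * X)) :
  exhaustive B -> choice_function c ->
  preference Q -> locally_strict Q -> closed Q' ->
  rationalizes c (range B) Q -> rationalizes c (range B) Q' -> Q `<=` Q'.
Proof.
move=> [Bd Bex] cP [Qc Qcl] Qls Q'cl QB Q'B [x y] Qxy; apply: contrapT => nQ'xy.
have Q'o := closed_openC Q'cl.
have [x' [y' [nQ' [_ nQyx]]]] : exists x' y', (~` Q') (x', y') /\
    strict_part Q x' y' by apply: (Qls x y Qxy); exact: open_nbhs_nbhs.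
pose s (w : X * X) := (w.2, w.1).
have nbhs_s : nbhs (x', y') (s @^-1` (~` Q)).
  apply: (@swap_continuous _ _ (x', y')).
  by apply: open_nbhs_nbhs; split => //; exact: closed_openC.
have [a [b [Da Db [nQ'ab nQba]]]] :=
  dense_prod_nbhs _ _ _ Bd (filterI (open_nbhs_nbhs (conj Q'o nQ')) nbhs_s).
(* Exhaustiveness applies to distinct alternatives; here they differ because completeness gives
   [Q (b, b)]. *)
have ab : a <> b.
  by move=> ab; apply: nQba; rewrite /s /= ab; have [] := Qc b b.
have [k Bk] := Bex a b Da Db ab.
have Bab : range B [set a; b] by exists k.
have [Qca _] := QB _ _ Bab; have [_ Q'cb] := Q'B _ _ Bab.
(* Choosing [a] would give [Q' (a, b)], choosing [b] would give [Q (b, a)]; both are excluded. *)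
by case: (cP a b) Qca Q'cb => -> ? ?; [exact: nQ'ab | exact: nQba].
Qed.

(** A comparison [z] made by all [Qn n] with [n >= k] persists in a cluster point, since missing the
    compact set [[set z]] is an open condition. *)
Lemma cluster_rationalizes {X : topologicalType} (B : nat -> set X)
    (c : set X -> X) (Qn : nat -> closed_set (X * X)%type)
    (Q : closed_set (X * X)%type) :
  (forall n, rationalizes c (experiments B n) (Qn n)) ->
  cluster (Qn @ \oo) Q -> rationalizes c (range B) Q.
Proof.
move=> Qn_rat QnQ x y [k _ Bk].
suff Qlim z : (forall n, (k <= n)%N -> (Qn n : set _) z) -> (Q : set _) z.
  by split; apply: Qlim => n kn; have [|] := Qn_rat n x y => //; exists k.
move=> Qnz; apply: contrapT => nQz.
have Qn_z : (Qn @ \oo) [set C : closed_set _ | (C : set (X * X)) z] by exists k.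
have Q_nz : nbhs Q
    [set C : closed_set _ | (C : set (X * X)) `&` [set z] = set0].
  apply: open_nbhs_nbhs; split.
    by apply: open_miss_compact; exact: compact_set1.
  by rewrite /= -subset0 => w [+ wz]; rewrite wz.
have [C [Cz nCz]] := QnQ _ _ Qn_z Q_nz.
by have : set0 z by rewrite -nCz.
Qed.

Theorem theorem1 (R : realType) (X : topologicalType)
    (X_lc : locally_compact [set: X])
    (X_sep : separable_space X)
    (X_cm : completely_metrizable R X)
    (P : set (closed_set (X * X)%type))
    (P_closed : closed P)
    (P_pref : forall Q, P Q ->
       preference (set_of_closed Q) /\ locally_strict (set_of_closed Q))
    (B : nat -> set X)
    (B_pair : forall k, binary_problem (B k))
    (B_exh : exhaustive B)
    (c : set X -> X)
    (c_choice : choice_function c)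
    (Qn : nat -> closed_set (X * X)%type)
    (Qn_P : forall n, P (Qn n))
    (Qn_rat : forall n,
       rationalizes c (experiments B n) (set_of_closed (Qn n))) :
  exists Q : closed_set (X * X)%type,
    [/\ P Q,
        preference_cvg (fun n => set_of_closed (Qn n)) (set_of_closed Q) &
        forall Qn' : nat -> closed_set (X * X)%type,
          (forall n, P (Qn' n)) ->
          (forall n,
             rationalizes c (experiments B n) (set_of_closed (Qn' n))) ->
          preference_cvg (fun n => set_of_closed (Qn' n)) (set_of_closed Q)].
Proof.
have clP Sn Q : (forall n, P (Sn n)) -> cluster (Sn @ \oo) Q -> P Q.
  move=> SnP SnQ; apply: P_closed => V QV; apply: SnQ => //.
  by exists 0%N => // n _; exact: SnP.
have [Q [_ QnQ]] := closed_set_compact (Qn @ \oo) _ filterT.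
have PQ := clP _ _ Qn_P QnQ.
(* [Q] was obtained from [Qn], yet [Sn] is arbitrary: every cluster point of [Sn] equals [Q], so one
   argument yields both convergence claims. *)
have lim Sn : (forall n, P (Sn n)) ->
    (forall n, rationalizes c (experiments B n) (Sn n)) ->
    preference_cvg (fun n => set_of_closed (Sn n)) Q.
  move=> SnP Sn_rat; apply: (closed_set_cvg_preference_cvg R) => //.
    by move=> n x; have [[+ _] _] := P_pref _ (SnP n) => /(_ x x)[].
  apply: (compact_unique_cluster_cvg _ _ closed_set_compact) => Q' SnQ'.
  have [Qp Qls] := P_pref _ PQ.
  have [Q'p Q'ls] := P_pref _ (clP _ _ SnP SnQ').
  have Qrat := cluster_rationalizes _ _ _ _ Qn_rat QnQ.
  have Q'rat := cluster_rationalizes _ _ _ _ Sn_rat SnQ'.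
  have Q'Q : (Q' : set _) = Q.
    apply/seteqP; split; apply: (locally_strict_rationalizes_subset B c) => //.
    - exact: closed_setP.
    - exact: closed_setP.
  case: {+}Q' {+}Q Q'Q => [C Ccl] [C' C'cl] /= CC'; subst C'.
  by congr ClosedSet; exact: Prop_irrelevance.
by exists Q; split => //; exact: lim.
Qed.
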